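(* Let $f:A\to\mathcal{P}(\Lambda)$ be an associated transition map, and let $\Omega_f(\Lambda)$ be the set of all $f$-ultrafilters on $\Lambda$, with the topology having the sets $\overline{f(a)}=\{\mathscr{U}\in\Omega_f(\Lambda)\mid f(a)\in\mathscr{U}\}$, $a\in A$, as a closed base. Then: (a) the space $\Omega_f(\Lambda)$ is a compact Hausdorff space; (b) $\mathrm{Max}(A)$ is homeomorphic to $\Omega_f(\Lambda)$.
   Context: All rings are commutative with unity. $\mathcal{P}(\Lambda)$ is the power set of $\Lambda$. For a ring $D$ and a nonempty set $\Lambda$, a map $\psi:D\to\mathcal{P}(\Lambda)$ is a semi-transition map on $D$ if: (i) $\psi(ab)=\psi(a)\cup\psi(b)$ for all $a,b\in D$; (ii) $\psi(1)=\emptyset$, and $\psi(a)=\Lambda$ if and only if $a=0$; (iii) for all $a,b\in D$ there is some $c$ in the ideal $(a,b)$ with $\psi(a)\cap\psi(b)=\psi(c)\subseteq\psi(a+b)$; moreover, if $\psi(a)\cap\psi(b)=\emptyset$, then the ideal $(a^m,b^n)$ is principal for some $m,n\in\mathbb{N}$ (positive integers). A pm-ring is a ring in which each prime ideal is contained in a unique maximal ideal. A transition map on $D$ is a semi-transition map $\psi:D\to\mathcal{P}(\Lambda)$, where $D$ is a pm-ring, such that: (T1) if $\lambda_1\neq\lambda_2$ in $\Lambda$, then there is $a\in D$ such that $\psi(a)$ contains exactly one of $\lambda_1,\lambda_2$; (T2) for all $\lambda\in\Lambda$ and $a\in D$ with $\lambda\notin\psi(a)$, there is $b\in D$ with $\lambda\in\psi(b)$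 and $\psi(a)\cap\psi(b)=\emptyset$. A ring is transitional if it is a pm-ring admitting a transition map. Given a transitional ring $D$ with transition map $\psi:D\to\mathcal{P}(\Lambda)$, put $S=\{d\in D\mid\psi(d)=\emptyset\}$ (multiplicatively closed); the associated transitional ring is $D_S=S^{-1}D$ and the associated transition map is $D_S\to\mathcal{P}(\Lambda)$, $d/s\mapsto\psi(d)$ (it is well defined and is a transition map). ''$f:A\to\mathcal{P}(\Lambda)$ is an associated transition map'' means that $A\cong D_S$ for such a $D$ and $f$ is the corresponding associated transition map. An $f$-filter on $\Lambda$ is a nonempty subfamily $\mathscr{F}$ of $f(A)=\{f(a)\mid a\in A\}$ with $\emptyset\notin\mathscr{F}$, closed under finite intersections, and such that $f(a)\in\mathscr{F}$, $c\in A$ and $f(a)\subseteq f(c)$ imply $f(c)\in\mathscr{F}$; an $f$-ultrafilter is a maximal $f$-filter. The sets $\overline{f(a)}$ do form a closed base of a topology. $\mathrm{Max}(A)$ is the set of maximal ideals of $A$ with the Zariski topology, with basic closed sets $\{M\in\mathrm{Max}(A)\mid a\in M\}$, $a\in A$. *)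

(* Defs.v *)
From HB Require Import structures.
From mathcomp Require Import all_boot all_order all_algebra generic_quotient.
From mathcomp Require Import ring.
From mathcomp Require Import all_classical.
From mathcomp Require Import topology.

Set Implicit Arguments.
Unset Strict Implicit.
Unset Printing Implicit Defensive.

Import GRing.Theory.
Local Open Scope ring_scope.
Local Open Scope classical_set_scope.
Local Open Scope quotient_scope.

(* Rings are [comPzRingType]s, which allow 1 = 0. The predicates on ideals in
   ring_quotient are only available over rings with 1 != 0. *)
Section Ideals.
Variable R : comPzRingType.
Implicit Types (I J P M : set R) (a b : R).

Definition ideal I : Prop :=
  [/\ I 0, forall x y, I x -> I y -> I (x + y) & forall r x, I x -> I (r * x)].

Definition ideal1 a : set R := [set r * a | r in setT].

Definition ideal2 a b : set R := [set x | exists r s, x = r * a + s * b].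

Definition principal I : Prop := exists c, I = ideal1 c.

Definition prime_ideal P : Prop :=
  [/\ ideal P, ~ P 1 & forall x y, P (x * y) -> P x \/ P y].

Definition maximal_ideal M : Prop :=
  [/\ ideal M, ~ M 1 & forall J, ideal J -> ~ J 1 -> M `<=` J -> J = M].

Definition pm_ring : Prop :=
  forall P, prime_ideal P -> exists! M, maximal_ideal M /\ P `<=` M.

Lemma maximal_ideal_prime M : maximal_ideal M -> prime_ideal M.
Proof.
move=> [[M0 MD MM] M1 Mmax]; split=> // x y Mxy.
have [Mx|nMx] := pselect (M x); [by left | right].
pose J : set R := [set z | exists m r, M m /\ z = m + r * x].
have idJ : ideal J.
  split=> [|z t [m [r [Mm ->]]] [n [s [Mn ->]]]|u z [m [r [Mm ->]]]].
  - by exists 0, 0; rewrite mul0r addr0.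
  - by exists (m + n), (r + s); split; [exact: MD | ring].
  - by exists (u * m), (u * r); split; [exact: MM | ring].
have MJ : M `<=` J by move=> m Mm; exists m, 0; rewrite mul0r addr0.
have Jx : J x by exists 0, 1; rewrite mul1r add0r.
have [[m [r [Mm e]]]|nJ1] := pselect (J 1); last first.
  by case: nMx; rewrite -(Mmax _ idJ nJ1 MJ).
have -> : y = y * m + r * (x * y) by rewrite -[LHS]mulr1 e; ring.
by apply: MD; apply: MM.
Qed.

End Ideals.

(* The ring of fractions S^-1 R: the quotient of R x S by
   (a, s) ~ (b, t) iff u * (a * t) = u * (b * s) for some u in S. *)
Module Localization.
Section Localization.
Variables (R : comPzRingType) (S : {pred R}) (hS : mulr_closed S).

Local Notation pre := (R * {s : R | s \in S})%type.

Definition equivb (x y : pre) : bool :=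
  `[< exists2 u, u \in S & u * (x.1 * val y.2) = u * (y.1 * val x.2) >].

Lemma equivb_refl : reflexive equivb.
Proof. by move=> x; apply/asboolP; exists 1; first exact: hS.1. Qed.

Lemma equivb_sym : symmetric equivb.
Proof. by move=> x y; apply/asboolP/asboolP => -[u Su e]; exists u. Qed.

Lemma equivb_trans : transitive equivb.
Proof.
move=> [b [t St]] [a [s Ss]] [c [r Sr]] /asboolP[u Su /= e1].
move=> /asboolP[v Sv /= e2]; apply/asboolP; exists (u * v * t) => /=.
  by do !apply: hS.2.
transitivity (v * r * (u * (a * t))); first by ring.
rewrite e1; transitivity (u * s * (v * (b * r))); first by ring.
by rewrite e2; ring.
Qed.

Canonical equivb_equiv := EquivRel equivb equivb_refl equivb_sym equivb_trans.

Definition type : Type := {eq_quot equivb}.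
HB.instance Definition _ := Choice.on type.

(* The fraction a / s. *)
Definition frac (a : R) (s : {s : R | s \in S}) : type := \pi_type (a, s).

Definition one_denom : {s : R | s \in S} := exist _ 1 hS.1.

Definition mul_denom (s t : {s : R | s \in S}) : {s : R | s \in S} :=
  exist _ (val s * val t) (hS.2 _ _ (valP s) (valP t)).

Lemma fracP x : exists a s, x = frac a s.
Proof. by elim/quotW: x => -[a s]; exists a, s. Qed.

Lemma frac_eqP a s b t :
  (exists2 u, u \in S & u * (a * val t) = u * (b * val s)) <->
  frac a s = frac b t.
Proof.
by split=> [e|/eqmodP /asboolP//]; apply/eqmodP/asboolP.
Qed.

Definition num (x : type) : R := (repr x).1.
Definition den (x : type) : {s : R | s \in S} := (repr x).2.

Lemma num_den x : frac (num x) (den x) = x.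
Proof. by rewrite /frac /num /den -surjective_pairing reprK. Qed.

Definition zero : type := frac 0 one_denom.
Definition one : type := frac 1 one_denom.
Definition opp x : type := frac (- num x) (den x).
Definition add x y : type :=
  frac (num x * val (den y) + num y * val (den x)) (mul_denom (den x) (den y)).
Definition mul x y : type := frac (num x * num y) (mul_denom (den x) (den y)).

Lemma opp_frac a s : opp (frac a s) = frac (- a) s.
Proof.
have /frac_eqP[u Su e] := num_den (frac a s).
by apply/frac_eqP; exists u => //; rewrite !mulNr !mulrN e.
Qed.

Lemma add_frac a s b t :
  add (frac a s) (frac b t) = frac (a * val t + b * val s) (mul_denom s t).
Proof.
have /frac_eqP[u Su e] := num_den (frac a s).
have /frac_eqP[v Sv e'] := num_den (frac b t).
apply/frac_eqP; exists (u * v); [exact: hS.2 | rewrite /= in e e' *].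
move: (num (frac a s)) (sval (den (frac a s))) e => a' s' e.
move: (num (frac b t)) (sval (den (frac b t))) e' => b' t' e'.
transitivity (v * t' * sval t * (u * (a' * sval s)) +
              u * s' * sval s * (v * (b' * sval t))); first by ring.
by rewrite e e'; ring.
Qed.

Lemma mul_frac a s b t :
  mul (frac a s) (frac b t) = frac (a * b) (mul_denom s t).
Proof.
have /frac_eqP[u Su e] := num_den (frac a s).
have /frac_eqP[v Sv e'] := num_den (frac b t).
apply/frac_eqP; exists (u * v); [exact: hS.2 | rewrite /= in e e' *].
move: (num (frac a s)) (sval (den (frac a s))) e => a' s' e.
move: (num (frac b t)) (sval (den (frac b t))) e' => b' t' e'.
transitivity ((u * (a' * sval s)) * (v * (b' * sval t))); first by ring.
by rewrite e e'; ring.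
Qed.

Let frac_eq a s b t : a * val t = b * val s -> frac a s = frac b t.
Proof. by move=> e; apply/frac_eqP; exists 1; [exact: hS.1 | rewrite e]. Qed.

Lemma addA : associative add.
Proof.
move=> x y z; have [a [s ->]] := fracP x; have [b [t ->]] := fracP y.
have [c [r ->]] := fracP z.
by rewrite !add_frac; apply: frac_eq => /=; ring.
Qed.

Lemma addC : commutative add.
Proof.
move=> x y; have [a [s ->]] := fracP x; have [b [t ->]] := fracP y.
by rewrite !add_frac; apply: frac_eq => /=; ring.
Qed.

Lemma add0 : left_id zero add.
Proof.
move=> x; have [a [s ->]] := fracP x.
by rewrite add_frac; apply: frac_eq => /=; ring.
Qed.

Lemma addN : left_inverse zero opp add.
Proof.
move=> x; have [a [s ->]] := fracP x.
by rewrite opp_frac add_frac; apply: frac_eq => /=; ring.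
Qed.

HB.instance Definition _ := GRing.isZmodule.Build type addA addC add0 addN.

Lemma mulA : associative mul.
Proof.
move=> x y z; have [a [s ->]] := fracP x; have [b [t ->]] := fracP y.
have [c [r ->]] := fracP z.
by rewrite !mul_frac; apply: frac_eq => /=; ring.
Qed.

Lemma mulC : commutative mul.
Proof.
move=> x y; have [a [s ->]] := fracP x; have [b [t ->]] := fracP y.
by rewrite !mul_frac; apply: frac_eq => /=; ring.
Qed.

Lemma mul1 : left_id one mul.
Proof.
move=> x; have [a [s ->]] := fracP x.
by rewrite mul_frac; apply: frac_eq => /=; ring.
Qed.

Lemma mulD : left_distributive mul add.
Proof.
move=> x y z; have [a [s ->]] := fracP x; have [b [t ->]] := fracP y.
have [c [r ->]] := fracP z.
by rewrite !(add_frac, mul_frac); apply: frac_eq => /=; ring.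
Qed.

HB.instance Definition _ :=
  GRing.Zmodule_isComPzRing.Build type mulA mulC mul1 mulD.

Lemma fracM a s b t : frac a s * frac b t = frac (a * b) (mul_denom s t).
Proof. exact: mul_frac. Qed.

End Localization.
End Localization.
HB.export Localization.

Notation localization := Localization.type.
Notation frac := Localization.frac.

Section TransitionMaps.
Variables (D : comPzRingType) (Lambda : Type).
Implicit Type psi : D -> set Lambda.

Record semi_transition_map psi : Prop := {
  st_nonempty : [set: Lambda] !=set0;
  st_mul : forall a b, psi (a * b) = psi a `|` psi b;
  st_one : psi 1 = set0;
  st_full : forall a, psi a = setT <-> a = 0;
  st_cap : forall a b, exists c,
    [/\ ideal2 a b c, psi a `&` psi b = psi c & psi c `<=` psi (a + b)];
  st_principal : forall a b, psi a `&` psi b = set0 ->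
    exists m n, [/\ (0 < m)%N, (0 < n)%N & principal (ideal2 (a ^+ m) (b ^+ n))]
}.

Record transition_map psi : Prop := {
  tm_pm : pm_ring D;
  tm_semi : semi_transition_map psi;
  tm_separates : forall l1 l2, l1 <> l2 ->
    exists a, (psi a l1 /\ ~ psi a l2) \/ (~ psi a l1 /\ psi a l2);
  tm_disjoint : forall l a, ~ psi a l ->
    exists b, psi b l /\ psi a `&` psi b = set0
}.

Definition empty_locus psi : {pred D} := [pred d | `[< psi d = set0 >]].

Lemma empty_locus_mulr_closed psi :
  transition_map psi -> mulr_closed (empty_locus psi).
Proof.
move=> /tm_semi h; split; first by apply/asboolP; exact: st_one h.
move=> x y /asboolP hx /asboolP hy; apply/asboolP.
by rewrite (st_mul h) hx hy setU0.
Qed.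

End TransitionMaps.

Definition associated_ring (D : comPzRingType) (Lambda : Type)
    (psi : D -> set Lambda) (hpsi : transition_map psi) : comPzRingType :=
  localization (empty_locus_mulr_closed hpsi).

Definition associated_transition_map (A : comPzRingType) (Lambda : Type)
    (f : A -> set Lambda) : Prop :=
  exists (D : comPzRingType) (psi : D -> set Lambda)
    (hpsi : transition_map psi) (phi : {rmorphism associated_ring hpsi -> A}),
  bijective phi /\
  forall d s, f (phi (frac (empty_locus_mulr_closed hpsi) d s)) = psi d.

Section Ultrafilters.
Variables (A : comPzRingType) (Lambda : Type) (f : A -> set Lambda).

Record f_filter (F : set (set Lambda)) : Prop := {
  ff_range : F `<=` range f;
  ff_nonempty : F !=set0;
  ff_proper : ~ F set0;
  ff_cap : forall X Y, F X -> F Y -> F (X `&` Y);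
  ff_up : forall a c, F (f a) -> f a `<=` f c -> F (f c)
}.

Definition f_ultrafilter (U : set (set Lambda)) : Prop :=
  f_filter U /\ forall F, f_filter F -> U `<=` F -> F = U.

(* The space Omega_f(Lambda). The set does not depend on the proof that f is an
   associated transition map, but the topology below does: this is what makes
   the sets [Omega_closed a] a closed base. *)
Definition Omega (_ : associated_transition_map f) : Type :=
  {U : set (set Lambda) | f_ultrafilter U}.

Hypothesis hf : associated_transition_map f.

Lemma associated_facts :
  [/\ f 1 = set0, forall x y, f (x * y) = f x `|` f y
    & forall x y, exists z, f x `&` f y = f z].
Proof.
have [D [psi [hpsi [phi [[g gK Kg] hphi]]]]] := hf.
have h := tm_semi hpsi.
have phiP x : exists d s, x = phi (frac (empty_locus_mulr_closed hpsi) d s).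
  have [d [s e]] := Localization.fracP (g x).
  by exists d, s; rewrite -e Kg.
split.
- by rewrite -(rmorph1 phi) hphi (st_one h).
- move=> x y; have [d [s ->]] := phiP x; have [e [t ->]] := phiP y.
  by rewrite -rmorphM /= Localization.fracM !hphi (st_mul h).
- move=> x y; have [d [s ->]] := phiP x; have [e [t ->]] := phiP y.
  have [c [_ de _]] := st_cap h d e; rewrite !hphi de.
  pose one := Localization.one_denom (empty_locus_mulr_closed hpsi).
  by exists (phi (frac (empty_locus_mulr_closed hpsi) c one)); rewrite hphi.
Qed.

Lemma f_ultrafilter_disjoint U a : f_ultrafilter U -> ~ U (f a) ->
  exists2 X, U X & X `&` f a = set0.
Proof.
move=> [hU Umax] nUa; apply: contrapT => hne.
have [_ _ fI] := associated_facts.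
pose F : set (set Lambda) :=
  [set Y | range f Y /\ exists2 X, U X & X `&` f a `<=` Y].
have FF : f_filter F.
  split.
  - by move=> Y [].
  - have [X UX] := ff_nonempty hU.
    by exists (f a); split; [exists a | exists X].
  - move=> [_ [X UX XY]]; apply: hne; exists X => //.
    by rewrite -subset0.
  - move=> _ _ [[x _ <-] [X UX hX]] [[y _ <-] [Y UY hY]]; split.
      by have [z ->] := fI x y; exists z.
    exists (X `&` Y); first exact: ff_cap hU _ _ _ _.
    by move=> l [[Xl Yl] al]; split; [apply: hX | apply: hY].
  - move=> x c [_ [X UX hX]] xc; split; first by exists c.
    by exists X => //; apply: subset_trans hX xc.
have UF : U `<=` F.
  move=> X UX; split; first exact: ff_range hU _ UX.
  by exists X => // l [].
have [X UX] := ff_nonempty hU.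
by apply: nUa; rewrite -(Umax _ FF UF); split; [exists a | exists X].
Qed.

Lemma f_ultrafilterM U a b :
  f_ultrafilter U -> U (f (a * b)) <-> U (f a) \/ U (f b).
Proof.
move=> UU; have [_ fM _] := associated_facts; rewrite fM; split; last first.
  by case=> h; rewrite -fM; apply: ff_up UU.1 _ _ h _; rewrite fM => l ?;
    [left | right].
move=> Uab; apply: contrapT => /not_orP[na nb].
have [X UX Xa] := f_ultrafilter_disjoint UU na.
have [Y UY Yb] := f_ultrafilter_disjoint UU nb.
apply: (ff_proper UU.1).
suff <- : X `&` Y `&` (f a `|` f b) = set0.
  by do !apply: (ff_cap UU.1).
rewrite -subset0 => l [[Xl Yl] [al|bl]].
- by rewrite -Xa.
- by rewrite -Yb.
Qed.

Definition Omega_closed (a : A) : set (Omega hf) := [set U | sval U (f a)].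

(* The complements of the members of the closed base. *)
Definition Omega_base : set (set (Omega hf)) := [set ~` Omega_closed a | a in setT].

Lemma Omega_base_cover : \bigcup_(V in Omega_base) id V = setT.
Proof.
rewrite -subTset => U _; exists (~` Omega_closed 1); first by exists 1.
rewrite /Omega_closed /=; have [-> _ _] := associated_facts.
exact: ff_proper (svalP U).1.
Qed.

Lemma Omega_base_join V W U : Omega_base V -> Omega_base W -> V U -> W U ->
  exists X, [/\ Omega_base X, X U & X `<=` V `&` W].
Proof.
move=> [a _ <-] [b _ <-] VU WU; exists (~` Omega_closed (a * b)).
split; first by exists (a * b).
- by move=> /(f_ultrafilterM _ _ (svalP U))[].
- by move=> T nT; split=> h; apply: nT; apply/(f_ultrafilterM _ _ (svalP T));
    [left | right].
Qed.

HB.instance Definition _ := gen_eqMixin (Omega hf).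
HB.instance Definition _ := gen_choiceMixin (Omega hf).
HB.instance Definition _ :=
  isBaseTopological.Build (Omega hf) Omega_base_cover Omega_base_join.

Lemma Omega_closedP (C : set (Omega hf)) :
  closed C <-> exists B : set A, C = \bigcap_(a in B) Omega_closed a.
Proof.
rewrite -openC; split=> [[V hV e]|[B ->]].
  exists [set a | V (~` Omega_closed a)]; rewrite -[C]setCK -e setC_bigcup.
  apply/seteqP; split=> U UV.
    by move=> a /UV /contrapT.
  by move=> W /[dup] VW /hV[a _ aW]; rewrite -aW; apply; apply: UV; rewrite /= aW.
rewrite setC_bigcap.
exists [set ~` Omega_closed a | a in B]; first by move=> _ [a Ba <-]; exists a.
by rewrite bigcup_image.
Qed.

End Ultrafilters.

Section MaximalSpectrum.
Variable A : comPzRingType.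

Definition Max : Type := {M : set A | maximal_ideal M}.

Definition Max_closed (a : A) : set Max := [set M | sval M a].

Definition Max_base : set (set Max) := [set ~` Max_closed a | a in setT].

Lemma Max_base_cover : \bigcup_(V in Max_base) id V = setT.
Proof.
rewrite -subTset => M _; exists (~` Max_closed 1); first by exists 1.
by have [_ M1 _] := svalP M.
Qed.

Lemma Max_base_join V W M : Max_base V -> Max_base W -> V M -> W M ->
  exists X, [/\ Max_base X, X M & X `<=` V `&` W].
Proof.
move=> [a _ <-] [b _ <-] VM WM; exists (~` Max_closed (a * b)).
split; first by exists (a * b).
- by have [_ _ Mp] := maximal_ideal_prime (svalP M) => /Mp[].
- move=> N nN; have [[_ _ NM] _ _] := svalP N.
  by split=> h; apply: nN; rewrite /Max_closed /=; [rewrite mulrC|]; apply: NM.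
Qed.

HB.instance Definition _ := gen_eqMixin Max.
HB.instance Definition _ := gen_choiceMixin Max.
HB.instance Definition _ :=
  isBaseTopological.Build Max Max_base_cover Max_base_join.

Lemma Max_closedP (C : set Max) :
  closed C <-> exists B : set A, C = \bigcap_(a in B) Max_closed a.
Proof.
rewrite -openC; split=> [[V hV e]|[B ->]].
  exists [set a | V (~` Max_closed a)]; rewrite -[C]setCK -e setC_bigcup.
  apply/seteqP; split=> U UV.
    by move=> a /UV /contrapT.
  by move=> W /[dup] VW /hV[a _ aW]; rewrite -aW; apply; apply: UV; rewrite /= aW.
rewrite setC_bigcap.
exists [set ~` Max_closed a | a in B]; first by move=> _ [a Ba <-]; exists a.
by rewrite bigcup_image.
Qed.

End MaximalSpectrum.

Definition homeomorphic (X Y : topologicalType) : Prop :=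
  exists (g : X -> Y) (h : Y -> X),
    [/\ cancel g h, cancel h g, continuous g & continuous h].

(* Main.v *)
(* [M |-> f(M)] and [U |-> f^-1(U)] are inverse bijections between maximal
   ideals and f-ultrafilters: if [f a] and [f b] are disjoint, then the element
   [c] of the ideal (a, b) with [f c = f a `&` f b = set0] is a unit of A, so a
   and b are comaximal. Hence both spaces inherit the compactness of Max A.
   For the Hausdorff property, pull distinct ultrafilters U and V back to primes
   P and Q of D avoiding S. If x in P and y in Q have disjoint images, then
   (x^m, y^n) = (c) with c in S; writing x^m = r c, y^n = s c and
   c = u x^m + v y^n, one gets u r + v s = 1 with r in P and s in Q. As D is a
   pm-ring, no prime lies in both P and Q, so x y = 0 for some x outside P and
   y outside Q, which separates U from V. *)
Require Import Defs.
From HB Require Import structures.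
From mathcomp Require Import all_boot all_order all_algebra.
From mathcomp Require Import ring.
From mathcomp Require Import all_classical.
From mathcomp Require Import topology.

Import GRing.Theory.
Local Open Scope ring_scope.
Local Open Scope classical_set_scope.

Lemma sval_inj (T : Type) (P : T -> Prop) : injective (@sval T P).
Proof. by move=> [x Px] [y Py] /= e; exact: eq_exist. Qed.

(** * Ideals avoiding a set, and comaximal primes in pm-rings *)

Section PrimeAndMaximalIdeals.
Context {R : comPzRingType}.
Implicit Types (I J M P Q T : set R).

Lemma idealX I a n : ideal I -> (0 < n)%N -> I a -> I (a ^+ n).
Proof. by move=> [_ _ IM]; case: n => // n _ Ia; rewrite exprSr; exact: IM. Qed.

Definition adjoin I x : set R := [set z | exists m r, I m /\ z = m + r * x].

Lemma ideal_adjoin I x : ideal I -> ideal (adjoin I x).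
Proof.
move=> [I0 ID IM]; split=> [|_ _ [m [r [Im ->]]] [n [s [In ->]]]|u _ [m [r [Im ->]]]].
- by exists 0, 0; rewrite mul0r addr0.
- by exists (m + n), (r + s); split; [exact: ID | ring].
- by exists (u * m), (u * r); split; [exact: IM | ring].
Qed.

Lemma sub_adjoin I x : I `<=` adjoin I x.
Proof. by move=> m Im; exists m, 0; rewrite mul0r addr0. Qed.

Lemma mem_adjoin I x : ideal I -> adjoin I x x.
Proof. by move=> [I0 _ _]; exists 0, 1; rewrite mul1r add0r. Qed.

(** One use of Zorn's lemma serves twice below: [T = [set 1]] yields maximal ideals, a
    multiplicatively closed [T] yields primes. *)
Lemma exists_ideal_maximal_avoiding T I : ideal I -> I `<=` ~` T ->
  exists P, [/\ ideal P, I `<=` P, P `<=` ~` T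
    & forall J, ideal J -> P `<=` J -> J `<=` ~` T -> J = P].
Proof.
move=> [I0 ID IM] IT.
(* [I] is added to every member so that the empty chain is harmless. *)
have [F FP Ftot|M [[idM MT] Mmax]] :=
  @Zorn_bigcup R [set J | ideal (I `|` J) /\ I `|` J `<=` ~` T].
- have lift X : F X -> I `|` X `<=` I `|` \bigcup_(Y in F) Y.
    by move=> FX x [?|Xx]; [left | right; exists X].
  split; [split|].
  + by left.
  + move=> x y [Ix|[X FX Xx]] [Iy|[Y FY Yy]].
    * by left; exact: ID.
    * have [[_ YD _] _] := FP Y FY.
      by apply: (lift Y FY); apply: YD; [left | right].
    * have [[_ XD _] _] := FP X FX.
      by apply: (lift X FX); apply: XD; [right | left].
    * have [[_ XD _] _] := FP X FX; have [[_ YD _] _] := FP Y FY.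
      have [XY|YX] := Ftot X Y FX FY.
        by apply: (lift Y FY); apply: YD; right=> //; exact: XY.
      by apply: (lift X FX); apply: XD; right=> //; exact: YX.
  + move=> r x [Ix|[X FX Xx]]; first by left; exact: IM.
    have [[_ _ XM] _] := FP X FX.
    by apply: (lift X FX); apply: XM; right.
  + move=> x [/IT//|[X FX Xx]]; have [_ XT] := FP X FX.
    by apply: XT; right.
- exists (I `|` M); split=> // J idJ MJ JT; apply: contrapT => neq.
  have IJ : I `|` J = J by apply/setUidr => x Ix; apply: MJ; left.
  apply: (Mmax J); rewrite /= ?IJ //; split=> [x Mx|JM]; first by apply: MJ; right.
  by apply: neq; apply/seteqP; split=> // x /JM; right.
Qed.

Lemma exists_maximal_ideal I : ideal I -> ~ I 1 ->
  exists2 M, maximal_ideal M & I `<=` M.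
Proof.
move=> idI I1; have [|M [idM IM M1 Mmax]] := @exists_ideal_maximal_avoiding [set 1] I idI.
  by move=> x Ix /= e; apply: I1; rewrite -e.
exists M => //; split=> // [M1'|J idJ J1 MJ]; first exact: M1 _ M1' _.
by apply: Mmax => // x Jx /= e; apply: J1; rewrite -e.
Qed.

(** An ideal [P] maximal among those avoiding [T] is prime: if [x] and [y] lie outside [P], both
    [adjoin P x] and [adjoin P y] meet [T], and were [x * y] in [P], the product of the two elements
    found would lie in both [P] and [T]. *)
Lemma exists_prime_avoiding T : T 1 -> (forall x y, T x -> T y -> T (x * y)) ->
  ~ T 0 -> exists2 P, prime_ideal P & P `<=` ~` T.
Proof.
move=> T1 TM T0; have id0 : ideal [set (0 : R)].
  by split=> [//|x y -> ->|r x ->]; rewrite /= ?addr0 ?mulr0.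
have [|P [idP _ PT Pmax]] := @exists_ideal_maximal_avoiding T _ id0.
  by move=> _ ->.
exists P => //; split=> // [/PT//|x y Pxy]; apply: contrapT => /not_orP[nPx nPy].
have meets z : ~ P z -> exists2 t, T t & adjoin P z t.
  move=> nPz; apply: contrapT => h; apply: nPz.
  rewrite -(Pmax (adjoin P z));
    [exact: mem_adjoin | exact: ideal_adjoin | exact: sub_adjoin |].
  by move=> t At Tt; apply: h; exists t.
have [_ /[swap] [[m [r [Pm ->]]]] Tx] := meets x nPx.
have [_ /[swap] [[n [s [Pn ->]]]] Ty] := meets y nPy.
have [_ PD PM] := idP; apply: PT (TM _ _ Tx Ty).
have -> : (m + r * x) * (n + s * y) = (n + s * y) * m + (r * x * n + r * s * (x * y)).
  by ring.
by apply: (PD); [|apply: PD]; exact: PM.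
Qed.

Lemma maximal_ideal_comaximal M x : maximal_ideal M -> ~ M x ->
  exists m r, M m /\ 1 = m + r * x.
Proof.
move=> [idM M1 Mmax] nMx; apply: contrapT => h; apply: nMx.
by rewrite -(Mmax _ (ideal_adjoin M x idM) h); [exact: mem_adjoin | exact: sub_adjoin].
Qed.

(** Otherwise the products of an element outside [P] and one outside [Q] form a multiplicative set
    without 0. A prime avoiding it lies in both [P] and [Q], so the maximal ideals above these two
    coincide and contain [p + q = 1]. *)
Lemma pm_ring_comaximal_primes P Q p q : pm_ring R -> prime_ideal P -> prime_ideal Q ->
  P p -> Q q -> p + q = 1 -> exists x y, [/\ ~ P x, ~ Q y & x * y = 0].
Proof.
move=> pm [idP P1 PM] [idQ Q1 QM] Pp Qq pq; apply: contrapT => h.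
pose T : set R := [set z | exists x y, [/\ ~ P x, ~ Q y & x * y = z]].
have [||//|N primeN NT] := exists_prime_avoiding T.
- by exists 1, 1; rewrite mulr1.
- move=> _ _ [x [y [Px Qy <-]]] [x' [y' [Px' Qy' <-]]].
  by exists (x * x'), (y * y'); split; [move=> /PM[] | move=> /QM[] | ring].
have NP : N `<=` P.
  by move=> z Nz; apply: contrapT => nPz; apply: (NT z Nz); exists z, 1; rewrite mulr1.
have NQ : N `<=` Q.
  by move=> z Nz; apply: contrapT => nQz; apply: (NT z Nz); exists 1, z; rewrite mul1r.
have [M1 maxM1 PM1] := exists_maximal_ideal P idP P1.
have [M2 maxM2 QM2] := exists_maximal_ideal Q idQ Q1.
have [M [_ uM]] := pm N primeN.
have e1 := uM M1 (conj maxM1 (subset_trans NP PM1)).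
have e2 := uM M2 (conj maxM2 (subset_trans NQ QM2)).
case: maxM1 => -[_ MD _] n1 _; apply: n1; rewrite -pq.
by apply: MD; [exact: PM1 | rewrite -e1 e2; exact: QM2].
Qed.

End PrimeAndMaximalIdeals.

(** * Comaximality from disjoint values of [psi] *)

Section SemiTransitionMaps.
Context {D : comPzRingType} {Lambda : Type} {psi : D -> set Lambda}.
Hypothesis hpsi : semi_transition_map psi.

Lemma semi_transition_mapX a n : (0 < n)%N -> psi (a ^+ n) = psi a.
Proof.
case: n => // n _; elim: n => [|n IH]; first by rewrite expr1.
by rewrite exprS (st_mul hpsi) IH setUid.
Qed.

Lemma disjoint_comaximal_primes (P Q : set D) a b :
  prime_ideal P -> prime_ideal Q ->
  (forall d, P d -> psi d <> set0) -> (forall d, Q d -> psi d <> set0) ->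
  P a -> Q b -> psi a `&` psi b = set0 -> exists p q, [/\ P p, Q q & p + q = 1].
Proof.
move=> [idP _ Pp] [idQ _ Qp] PS QS Pa Qb ab.
have [m [n [m0 n0 [c abc]]]] := st_principal hpsi ab.
have [r _ er] : ideal1 c (a ^+ m) by rewrite -abc; exists 1, 0; ring.
have [s _ es] : ideal1 c (b ^+ n) by rewrite -abc; exists 0, 1; ring.
have [u [v ec]] : ideal2 (a ^+ m) (b ^+ n) c by rewrite abc; exists 1; rewrite ?mul1r.
(* [c] divides both powers, so [psi c] lies in both [psi a] and [psi b]. *)
have c0 : psi c = set0.
  rewrite -subset0 -ab -(semi_transition_mapX a m m0) -(semi_transition_mapX b n n0).
  by rewrite -er -es !(st_mul hpsi) => l cl; split; right.
have Pr : P r.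
  by have [//|/PS] : P r \/ P c by apply: Pp; rewrite er; exact: idealX.
have Qs : Q s.
  by have [//|/QS] : Q s \/ Q c by apply: Qp; rewrite es; exact: idealX.
exists (u * r), (v * s); split; first by case: idP => _ _; exact.
  by case: idQ => _ _; exact.
(* Multiplying by [c] leaves [psi] unchanged, and only 0 has full value, so [c] can be cancelled
   from [c * (u * r + v * s - 1) = 0]. *)
apply/eqP; rewrite -subr_eq0; apply/eqP/(st_full hpsi).
rewrite -[LHS]set0U -c0 -(st_mul hpsi); apply/(st_full hpsi).
have -> : c * (u * r + v * s - 1) = u * (r * c) + v * (s * c) - c by ring.
by rewrite er es -ec subrr.
Qed.

End SemiTransitionMaps.

(** * Units and intersections in the ring of fractions *)

Section AssociatedTransitionMaps.
Context {A : comPzRingType} {Lambda : Type} {f : A -> set Lambda}.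
Hypothesis hf : associated_transition_map f.

Lemma associated_map0 : f 0 = setT.
Proof.
have [D [psi [hpsi [phi [_ hphi]]]]] := hf.
by rewrite -(rmorph0 phi) hphi; apply/(st_full (tm_semi hpsi)).
Qed.

Lemma associated_map_unit a : f a = set0 -> exists b, b * a = 1.
Proof.
have [D [psi [hpsi [phi [[g gK Kg] hphi]]]]] := hf.
have [d [s e]] := Localization.fracP (g a); rewrite -(Kg a) e hphi => d0.
have Sd : d \in empty_locus psi by apply/asboolP.
(* Since [psi d] is empty, [d] is itself a denominator: the inverse of [d / s] is [s / d]. *)
exists (phi (Localization.frac _ (val s) (exist _ d Sd))).
rewrite -rmorphM Localization.fracM -[RHS](rmorph1 phi); congr (phi _).
by apply/Localization.frac_eqP; exists 1;
  [exact: (empty_locus_mulr_closed hpsi).1 | rewrite /=; ring].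
Qed.

Lemma associated_map_cap a b : exists c,
  [/\ ideal2 a b c, f a `&` f b = f c & f c `<=` f (a + b)].
Proof.
have [D [psi [hpsi [phi [[g gK Kg] hphi]]]]] := hf.
have h := tm_semi hpsi.
have S0 (s : {s : D | s \in empty_locus psi}) : psi (val s) = set0.
  exact/asboolP/(valP s).
have [d [s ea]] := Localization.fracP (g a); have [e [t eb]] := Localization.fracP (g b).
rewrite -(Kg a) -(Kg b) ea eb.
(* These are the numerators over the common denominator [s * t]; the factors [s] and [t] do not
   change [psi]. *)
have [c [[u [v ec]] dec csub]] := st_cap h (d * val t) (e * val s).
pose one := Localization.one_denom (empty_locus_mulr_closed hpsi).
exists (phi (Localization.frac _ c one)); split.
(* The extra factors clear denominators: [u * t * s] times [d / s] is [u * (d * t)], and likewise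
   for [e / t]. *)
- exists (phi (Localization.frac _ (u * val t * val s) one)),
    (phi (Localization.frac _ (v * val t * val s) one)).
  rewrite -!rmorphM -rmorphD; congr (phi _).
  rewrite !Localization.fracM [RHS]Localization.add_frac.
  apply/Localization.frac_eqP; exists 1; first exact: (empty_locus_mulr_closed hpsi).1.
  by rewrite ec /=; ring.
- by rewrite !hphi -dec !(st_mul h) !S0 !setU0.
- by rewrite -rmorphD [X in _ `<=` f (phi X)]Localization.add_frac !hphi.
Qed.

Lemma associated_map_comaximal a b : f a `&` f b = set0 -> exists r s, r * a + s * b = 1.
Proof.
have [c [[u [v ->]] -> _]] := associated_map_cap a b => /associated_map_unit[w e].
by exists (w * u), (w * v); rewrite -e; ring.
Qed.

(** * Correspondence between ultrafilters and maximal ideals *)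

Lemma f_ultrafilter_ideal U : f_ultrafilter f U -> ideal (f @^-1` U).
Proof.
move=> [hU _]; split; rewrite /preimage /=.
- have [X UX] := ff_nonempty hU; have [x _ e] := ff_range hU UX.
  by apply: (ff_up hU (a := x)); rewrite ?e // associated_map0.
- move=> a b Ua Ub; have [c [_ e s]] := associated_map_cap a b.
  by apply: (ff_up hU _ s); rewrite -e; exact: (ff_cap hU).
- move=> r a Ua; apply: ff_up hU _ _ Ua _.
  by have [_ -> _] := associated_facts hf; right.
Qed.

(** If [f b] is not in [U], it is disjoint from some member [f a]; then [a] and [b] are comaximal,
    so no proper ideal containing the preimage of [U] contains [b]. *)
Lemma f_ultrafilter_maximal_ideal U : f_ultrafilter f U -> maximal_ideal (f @^-1` U).
Proof.
move=> UU; have [f1 fM _] := associated_facts hf.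
split; first exact: f_ultrafilter_ideal.
  by rewrite /preimage /= f1; exact: ff_proper UU.1.
move=> J [_ JD JM] J1 UJ; apply/seteqP; split=> // b Jb; apply: contrapT => nUb.
have [X UX] := f_ultrafilter_disjoint hf UU nUb.
have [a _ ea] := ff_range UU.1 UX; rewrite -ea => /associated_map_comaximal[r [s e]].
by apply: J1; rewrite -e; apply: JD; apply: JM => //; apply: UJ; rewrite /preimage /= ea.
Qed.

Lemma maximal_ideal_no_disjoint M a b : maximal_ideal M -> M a -> M b ->
  f a `&` f b <> set0.
Proof.
move=> [[_ MD MM] M1 _] Ma Mb /associated_map_comaximal[r [s e]].
by apply: M1; rewrite -e; apply: MD; exact: MM.
Qed.

(** Write [1 = m + r * a]: then [f m] and [f (r * a)] meet inside [f 1 = set0], and [f a] is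
    contained in [f (r * a)]. *)
Lemma maximal_ideal_disjoint M a : maximal_ideal M -> ~ M a ->
  exists2 m, M m & f m `&` f a = set0.
Proof.
move=> maxM nMa; have [m [r [Mm e]]] := maximal_ideal_comaximal M a maxM nMa.
exists m => //; rewrite -subset0; have [f1 fM _] := associated_facts hf.
have [c [_ mra csub]] := associated_map_cap m (r * a).
move: csub; rewrite -e f1 -mra fM; apply: subset_trans.
by move=> l [? ?]; split=> //; right.
Qed.

(** This makes the image of [M] upward closed and lets [M] be recovered from it. Were [c] outside
    [M], some [f m] with [m] in [M] would miss [f c], hence [f a]. *)
Lemma maximal_ideal_up M a c : maximal_ideal M -> M a -> f a `<=` f c -> M c.
Proof.
move=> maxM Ma ac; apply: contrapT => /(maximal_ideal_disjoint M c maxM)[m Mm mc].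
apply: (maximal_ideal_no_disjoint M m a maxM Mm Ma).
by rewrite -subset0 -mc => l [? ?]; split=> //; exact: ac.
Qed.

Lemma preimage_image_maximal_ideal M : maximal_ideal M -> f @^-1` (f @` M) = M.
Proof.
move=> maxM; apply/seteqP; split=> [a [b Mb e]|a Ma]; last by exists a.
by apply: maximal_ideal_up maxM Mb _; rewrite e.
Qed.

Lemma maximal_ideal_f_ultrafilter M : maximal_ideal M -> f_ultrafilter f (f @` M).
Proof.
move=> maxM; have [[M0 MD MM] M1 _] := maxM; split.
  split.
  - by move=> _ [a _ <-]; exists a.
  - by exists (f 0), 0.
  - by move=> [a Ma a0]; apply: (maximal_ideal_no_disjoint M a a maxM); rewrite ?a0 ?setI0.
  - move=> _ _ [a Ma <-] [b Mb <-]; have [c [[r [s ec]] -> _]] := associated_map_cap a b.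
    by exists c => //; rewrite ec; apply: MD; exact: MM.
  - by move=> a c [b Mb <-] bc; exists c => //; exact: maximal_ideal_up maxM Mb bc.
move=> F hF MF; apply/seteqP; split=> // X FX; have [b _ eb] := ff_range hF FX.
rewrite -eb; exists b => //; apply: contrapT.
move=> /(maximal_ideal_disjoint M b maxM)[m Mm mb].
apply: (ff_proper hF); rewrite -mb; apply: (ff_cap hF); last by rewrite eb.
by apply: MF; exists m.
Qed.

(** * Separation of distinct ultrafilters *)

Lemma f_ultrafilters_disjoint U V : f_ultrafilter f U -> f_ultrafilter f V -> U <> V ->
  exists X Y, [/\ U X, V Y & X `&` Y = set0].
Proof.
move=> UU VV neq; apply: contrapT => h; apply: neq.
apply/esym/(UU.2 _ VV.1) => X UX; apply: contrapT => nVX.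
have [x _ ex] := ff_range UU.1 UX; rewrite -ex in nVX.
have [Y VY YX] := f_ultrafilter_disjoint hf VV nVX.
by apply: h; exists X, Y; split=> //; rewrite -ex setIC.
Qed.

Lemma f_ultrafilters_separated U V : f_ultrafilter f U -> f_ultrafilter f V -> U <> V ->
  exists x y, [/\ ~ U (f x), ~ V (f y) & f (x * y) = setT].
Proof.
move=> UU VV neq; have [D [psi [hpsi [phi [[g gK Kg] hphi]]]]] := hf.
have h := tm_semi hpsi; have [_ fM _] := associated_facts hf.
(* The argument moves to [D], where the pm condition is given; [j] is the canonical map back to
   [A]. *)
pose j d := phi (Localization.frac _ d (Localization.one_denom (empty_locus_mulr_closed hpsi))).
have fj d : f (j d) = psi d by rewrite hphi.
have rangej W X : f_ultrafilter f W -> W X -> exists d, psi d = X.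
  move=> WW /(ff_range WW.1)[x _ <-]; have [d [s e]] := Localization.fracP (g x).
  by exists d; rewrite -(Kg x) e hphi.
have primeW W : f_ultrafilter f W -> prime_ideal (psi @^-1` W).
  move=> WW; have [W0 WD WM] := f_ultrafilter_ideal W WW.
  split; [split|by rewrite /preimage /= (st_one h); exact: ff_proper WW.1|].
  - by have := W0; rewrite /preimage /= associated_map0 (iffRL (st_full h 0) erefl).
  - move=> a b Wa Wb; rewrite /preimage /=.
    have [c [_ e s]] := st_cap h a b; rewrite -fj.
    by apply: (ff_up WW.1 (a := j c)); rewrite !fj // -e; exact: (ff_cap WW.1).
  - move=> r a Wa; rewrite /preimage /= -fj.
    by apply: (ff_up WW.1 (a := j a)); rewrite !fj // (st_mul h); right.
  - move=> a b; rewrite /preimage /= (st_mul h) -!fj -fM.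
    by move=> /(f_ultrafilterM hf _ _ WW).
have [X [Y [UX VY ab]]] := f_ultrafilters_disjoint U V UU VV neq.
have [a ea] := rangej U X UU UX; have [b eb] := rangej V Y VV VY; subst X Y.
have avoid W : f_ultrafilter f W -> forall d, (psi @^-1` W) d -> psi d <> set0.
  by move=> WW d Wd d0; apply: (ff_proper WW.1); rewrite -d0.
have [p [q [Pp Qq pq]]] := disjoint_comaximal_primes h _ _ _ _ (primeW U UU)
  (primeW V VV) (avoid U UU) (avoid V VV) UX VY ab.
have [x [y [nx ny xy]]] := pm_ring_comaximal_primes _ _ _ _ (tm_pm hpsi) (primeW U UU)
  (primeW V VV) Pp Qq pq.
exists (j x), (j y); rewrite fM !fj; split=> //.
by rewrite -(st_mul h) xy; apply/(st_full h).
Qed.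

End AssociatedTransitionMaps.

(** * Topology of the two spaces *)

Lemma nbhs_MaxP {A : comPzRingType} (M : Max A) (V : set (Max A)) :
  nbhs M V -> exists2 a, ~ sval M a & ~` @Max_closed A a `<=` V.
Proof.
rewrite nbhsE => -[W [oW WM] WV].
have [B eB] : exists B : set A, ~` W = \bigcap_(a in B) @Max_closed A a.
  by apply/Max_closedP; rewrite closedC.
have : ~ (\bigcap_(a in B) @Max_closed A a) M by rewrite -eB; apply.
move=> /existsNP[a /not_implyP[Ba nMa]]; exists a => // N nNa; apply: WV.
apply: contrapT => nWN; apply: nNa.
by have : (~` W) N by []; rewrite eB; exact.
Qed.

(** For a proper filter [F], the [a] whose basic closed set belongs to [F] form a proper ideal. Any
    maximal [M] above it is a cluster point: a member of [F] missing the basic neighbourhood given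
    by some [a] outside [M] would put [a] in that ideal. *)
Lemma compact_Max (A : comPzRingType) : compact [set: Max A].
Proof.
move=> F PF _; pose I : set A := [set a | F (@Max_closed A a)].
have idI : ideal I.
  split.
  - rewrite /I /= (_ : Max_closed _ = setT); first exact: filterT.
    by rewrite -subTset => M _; have [[M0 _ _] _ _] := svalP M.
  - move=> x y Fx Fy; apply: filterS (filterI Fx Fy) => M [Mx My].
    by have [[_ MD _] _ _] := svalP M; exact: MD.
  - by move=> r x; apply: filterS => M Mx; have [[_ _ MM] _ _] := svalP M; exact: MM.
have [|M maxM IM] := exists_maximal_ideal I idI.
  move=> F1; apply: (@filter_not_empty _ F).
  by apply: filterS F1 => M; have [_ M1 _] := svalP M.
exists (exist _ M maxM); split=> // B V FB /nbhs_MaxP[a nMa aV].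
apply: contrapT => BV; apply: nMa; apply: IM; apply: filterS FB => N BN.
by apply: contrapT => nNa; apply: BV; exists N; split=> //; exact: aV.
Qed.

Lemma Max_Omega_homeomorphic (A : comPzRingType) (Lambda : Type) (f : A -> set Lambda)
  (hf : associated_transition_map f) : homeomorphic (Max A) (Omega hf).
Proof.
pose g (M : Max A) : Omega hf := exist _ _ (maximal_ideal_f_ultrafilter hf _ (svalP M)).
pose h (U : Omega hf) : Max A := exist _ _ (f_ultrafilter_maximal_ideal hf _ (svalP U)).
exists g, h; split.
- by move=> M; apply: sval_inj; exact: preimage_image_maximal_ideal hf _ (svalP M).
- move=> U; apply: sval_inj; apply/seteqP; split=> [_ [a Ua <-]//|X UX].
  by have [a _ e] := ff_range (svalP U).1 UX; exists a; rewrite /= /preimage /= ?e.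
(* Both maps match the basic closed sets indexed by the same [a], so the same index set [B] works in
   each direction. *)
- apply/continuous_closedP => C /Omega_closedP[B ->]; apply/Max_closedP; exists B.
  rewrite preimage_bigcap; apply: eq_bigcapr => a _.
  apply/seteqP; split=> M Ma.
    by rewrite /Max_closed /= -(preimage_image_maximal_ideal hf _ (svalP M)).
  by exists a.
- by apply/continuous_closedP => C /Max_closedP[B ->]; apply/Omega_closedP; exists B.
Qed.

Theorem theorem7p5 (A : comPzRingType) (Lambda : Type) (f : A -> set Lambda)
    (hf : associated_transition_map f) :
  (compact [set: Omega hf] /\ hausdorff_space (Omega hf)) /\
  homeomorphic (Max A) (Omega hf).
Proof.
have homeo := Max_Omega_homeomorphic A Lambda f hf; split=> //; split.
  have [g [h [gK hK cg _]]] := homeo.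
  rewrite (_ : [set: Omega hf] = g @` [set: Max A]).
    by apply: continuous_compact (compact_Max A); exact: continuous_subspaceT.
  by apply/esym; rewrite -subTset => U _; exists (h U).
rewrite open_hausdorff => U V /eqP neq.
have [|x [y [Ux Vy xy]]] := f_ultrafilters_separated hf _ _ (svalP U) (svalP V).
  by move=> e; apply: neq; exact: sval_inj.
have oO a : open (~` @Omega_closed _ _ f hf a).
  by rewrite openC; apply/Omega_closedP; exists [set a]; rewrite bigcap_set1.
exists (~` @Omega_closed _ _ f hf x, ~` @Omega_closed _ _ f hf y) => /=.
  by rewrite !inE.
split=> //; apply/eqP; rewrite -subset0 => W [Wx Wy].
(* [W] contains [setT = f (x * y)], hence [f x] or [f y], so it cannot lie in both open sets. *)
suff /(f_ultrafilterM hf _ _ (svalP W))[//|//] : sval W (f (x * y)).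
rewrite xy -(associated_map0 hf).
by have [] := f_ultrafilter_ideal hf _ (svalP W).
Qed.
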